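(* Let $A$ be a commutative unital $\mathbb{R}$-algebra, $D$ a multiplicative subset of $A$ containing $1$, $\mathcal{X}$ a nonempty Hausdorff topological space and $\hat{\ }\colon A\to\mathcal{C}(\mathcal{X},\mathbb{R})$, $a\mapsto\hat a$, an $\mathbb{R}$-algebra homomorphism. Suppose that: (1) there exists $q\in A$ such that $\hat q\ge 0$ on $\mathcal{X}$ and, for each integer $k\ge 1$, the set $\mathcal{X}_k=\{x\in\mathcal{X}\mid\hat q(x)\le k\}$ is compact; (2) for every $d\in D$, the zero set $\mathcal{Z}(\hat d)$ of $\hat d$ in $\mathcal{X}$ has empty interior; (3) every open subset of $\mathcal{X}$ is $\sigma$-compact (a countable union of compact sets). Then for any linear functional $L\colon D^{-1}A\to\mathbb{R}$ satisfying $$\forall a\in A,\ \forall d\in D:\quad \hat a\hat d\ge 0\text{ on }\mathcal{X}\ \Rightarrow\ L(a/d)\ge 0,$$ there exists a Borel measure $\mu$ on $\mathcal{X}$ such that $$\forall a\in A,\ \forall d\in D:\quad L(a/d)=\int_{\mathcal{X}}\hat a/\hat d\;d\mu.$$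
   Context: $\mathcal{C}(\mathcal{X},\mathbb{R})$ is the $\mathbb{R}$-algebra of continuous real-valued functions on $\mathcal{X}$. Measures are positive. The function $\hat a/\hat d$ is defined outside $\mathcal{Z}(\hat d)$; the integral formula is understood to include that $\hat a/\hat d$ is defined $\mu$-almost everywhere (i.e. $\mu(\mathcal{Z}(\hat d))=0$) and $\mu$-integrable. *)

(* Defs.v *)
From HB Require Import structures.
From mathcomp Require Import all_boot all_order all_algebra.
From mathcomp Require Import generic_quotient ring.
From mathcomp Require Import all_classical all_reals all_analysis.

Set Implicit Arguments.
Unset Strict Implicit.
Unset Printing Implicit Defensive.

Import Order.TTheory GRing.Theory Num.Theory.
Import numFieldNormedType.Exports.

Local Open Scope classical_set_scope.
Local Open Scope ring_scope.
Local Open Scope quotient_scope.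

Section Localization.
Variables (A : comPzRingType) (D : mulrClosed A).

Definition denominator := {d : A | d \in D}.

Definition den (d : A) (dD : d \in D) : denominator := exist _ d dD.

Definition den1 : denominator := den (rpred1 D).

Definition denM (d e : denominator) : denominator :=
  den (rpredM (valP d) (valP e)).

(* The factor u is needed because D may contain zero divisors of A. *)
Definition loc_eqv (x y : A * denominator) : bool :=
  `[< exists2 u : A, u \in D & u * (x.1 * val y.2 - y.1 * val x.2) = 0 >].

Lemma loc_eqv_refl : reflexive loc_eqv.
Proof.
by move=> x; apply/asboolP; exists 1; rewrite ?rpred1 // subrr mulr0.
Qed.

Lemma loc_eqv_sym : symmetric loc_eqv.
Proof.
move=> x y; apply/asboolP/asboolP => -[u uD e]; exists u => //.
- by rewrite -opprB mulrN e oppr0.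
- by rewrite -opprB mulrN e oppr0.
Qed.

Lemma loc_eqv_trans : transitive loc_eqv.
Proof.
move=> [b [e eD]] [a [d dD]] [c [f fD]].
move=> /asboolP[u uD /= h1] /asboolP[v vD /= h2].
apply/asboolP; exists (u * v * e) => /=; first by rewrite !rpredM.
transitivity (v * f * (u * (a * e - b * d)) + u * d * (v * (b * f - c * e))).
  by ring.
by rewrite h1 h2 !mulr0 addr0.
Qed.

Canonical loc_equiv := EquivRel loc_eqv loc_eqv_refl loc_eqv_sym loc_eqv_trans.

(* D^-1 A; it is the zero ring when 0 \in D, hence only a comPzRingType. *)
Definition localization := {eq_quot loc_eqv}.

HB.instance Definition _ : EqQuotient _ loc_eqv localization :=
  EqQuotient.on localization.
HB.instance Definition _ := Choice.on localization.

Definition locfrac (a d : A) (dD : d \in D) : localization :=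
  \pi_localization (a, den dD).

Lemma loc_eqmodP (x y : A * denominator) :
  reflect (exists2 u : A, u \in D & u * (x.1 * val y.2 - y.1 * val x.2) = 0)
          (x == y %[mod localization]).
Proof. by rewrite eqmodE; apply: asboolP. Qed.

Lemma loc_reprP (x : A * denominator) : exists2 u : A, u \in D &
  u * ((repr (\pi_localization x)).1 * val x.2
       - x.1 * val (repr (\pi_localization x)).2) = 0.
Proof. by apply/loc_eqmodP; rewrite reprK. Qed.

Definition addl (x y : A * denominator) : A * denominator :=
  (x.1 * val y.2 + y.1 * val x.2, denM x.2 y.2).
Definition loc_add := lift_op2 localization addl.

Lemma pi_loc_add : {morph \pi : x y / addl x y >-> loc_add x y}.
Proof.
move=> x y; unlock loc_add; apply/eqP/loc_eqmodP => /=.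
have [u uD hu] := loc_reprP x; have [v vD hv] := loc_reprP y.
move: (repr _) hu (repr _) hv => [a' [d' ?]] /= hu [b' [e' ?]] /= hv.
case: x y hu hv => [a [d ?]] [b [e ?]] /= hu hv.
exists (u * v); first by rewrite rpredM.
transitivity (- (v * e * e' * (u * (a' * d - a * d')) +
  u * d * d' * (v * (b' * e - b * e')))); first by ring.
by rewrite hu hv !mulr0 addr0 oppr0.
Qed.
Canonical pi_loc_add_morph := PiMorph2 pi_loc_add.

Definition mull (x y : A * denominator) : A * denominator :=
  (x.1 * y.1, denM x.2 y.2).
Definition loc_mul := lift_op2 localization mull.

Lemma pi_loc_mul : {morph \pi : x y / mull x y >-> loc_mul x y}.
Proof.
move=> x y; unlock loc_mul; apply/eqP/loc_eqmodP => /=.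
have [u uD hu] := loc_reprP x; have [v vD hv] := loc_reprP y.
move: (repr _) hu (repr _) hv => [a' [d' ?]] /= hu [b' [e' ?]] /= hv.
case: x y hu hv => [a [d ?]] [b [e ?]] /= hu hv.
exists (u * v); first by rewrite rpredM.
transitivity (- (v * b' * e * (u * (a' * d - a * d')) +
  u * a * d' * (v * (b' * e - b * e')))); first by ring.
by rewrite hu hv !mulr0 addr0 oppr0.
Qed.
Canonical pi_loc_mul_morph := PiMorph2 pi_loc_mul.

Definition oppl (x : A * denominator) : A * denominator := (- x.1, x.2).
Definition loc_opp := lift_op1 localization oppl.

Lemma pi_loc_opp : {morph \pi : x / oppl x >-> loc_opp x}.
Proof.
move=> x; unlock loc_opp; apply/eqP/loc_eqmodP => /=.
have [u uD hu] := loc_reprP x; exists u => //.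
by rewrite !mulNr opprK addrC.
Qed.
Canonical pi_loc_opp_morph := PiMorph1 pi_loc_opp.

Definition loc0 : localization := \pi_localization (0, den1).
Definition loc1 : localization := \pi_localization (1, den1).

Local Ltac loc_ring :=
  apply/eqP/loc_eqmodP; exists 1; rewrite ?rpred1 //= /val /=; ring.

Lemma loc_addA : associative loc_add.
Proof.
by elim/quotW=> x; elim/quotW=> y; elim/quotW=> z; rewrite !piE; loc_ring.
Qed.

Lemma loc_addC : commutative loc_add.
Proof. by elim/quotW=> x; elim/quotW=> y; rewrite !piE; loc_ring. Qed.

Lemma loc_add0 : left_id loc0 loc_add.
Proof. by elim/quotW=> x; rewrite /loc0 !piE; loc_ring. Qed.

Lemma loc_addN : left_inverse loc0 loc_opp loc_add.
Proof. by elim/quotW=> x; rewrite /loc0 !piE; loc_ring. Qed.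

HB.instance Definition _ :=
  GRing.isZmodule.Build localization loc_addA loc_addC loc_add0 loc_addN.

Lemma loc_mulA : associative loc_mul.
Proof.
by elim/quotW=> x; elim/quotW=> y; elim/quotW=> z; rewrite !piE; loc_ring.
Qed.

Lemma loc_mulC : commutative loc_mul.
Proof. by elim/quotW=> x; elim/quotW=> y; rewrite !piE; loc_ring. Qed.

Lemma loc_mul1 : left_id loc1 loc_mul.
Proof. by elim/quotW=> x; rewrite /loc1 !piE; loc_ring. Qed.

Lemma loc_mulDl : left_distributive loc_mul loc_add.
Proof.
by elim/quotW=> x; elim/quotW=> y; elim/quotW=> z; rewrite !piE; loc_ring.
Qed.

HB.instance Definition _ := GRing.Zmodule_isComPzRing.Build localization
  loc_mulA loc_mulC loc_mul1 loc_mulDl.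

Lemma locfrac_eq (a d b e : A) (dD : d \in D) (eD : e \in D) :
  locfrac a dD = locfrac b eD <->
  exists2 u : A, u \in D & u * (a * e - b * d) = 0.
Proof.
rewrite /locfrac; split=> [/eqP/loc_eqmodP[u uD /= h]|[u uD h]].
  by exists u.
by apply/eqP/loc_eqmodP; exists u.
Qed.

Lemma locfracD (a d b e : A) (dD : d \in D) (eD : e \in D) :
  locfrac a dD + locfrac b eD = locfrac (a * e + b * d) (rpredM dD eD).
Proof.
by rewrite /locfrac -[LHS]pi_loc_add /addl; do 2!congr (_ _); exact: val_inj.
Qed.

Lemma locfracM (a d b e : A) (dD : d \in D) (eD : e \in D) :
  locfrac a dD * locfrac b eD = locfrac (a * b) (rpredM dD eD).
Proof.
by rewrite /locfrac -[LHS]pi_loc_mul /mull; do 2!congr (_ _); exact: val_inj.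
Qed.

End Localization.

Section LocalizationModule.
Variables (R : pzRingType) (A : comAlgType R) (D : mulrClosed A).
Local Notation loc := (localization D).

Definition scalel (k : R) (x : A * denominator D) : A * denominator D :=
  (k *: x.1, x.2).
Definition loc_scale (k : R) (x : loc) : loc := \pi_loc (scalel k (repr x)).

Lemma pi_loc_scale k x :
  loc_scale k (\pi_loc x) = \pi_loc (scalel k x).
Proof.
apply/eqP/loc_eqmodP => /=; have [u uD hu] := loc_reprP x; exists u => //.
by rewrite -!scalerAl -scalerBr -scalerAr hu scaler0.
Qed.

Lemma loc_scaleA k l x : loc_scale k (loc_scale l x) = loc_scale (k * l) x.
Proof.
by elim/quotW: x => x; rewrite 2!(pi_loc_scale _ x) pi_loc_scale /scalel /= scalerA.
Qed.

Lemma loc_scale1 : left_id 1 loc_scale.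
Proof.
by elim/quotW=> -[a d]; rewrite pi_loc_scale /scalel /= scale1r.
Qed.

Lemma loc_scaleDr : right_distributive loc_scale +%R.
Proof.
move=> k; elim/quotW=> x; elim/quotW=> y.
rewrite -[X in loc_scale k X]pi_loc_add (pi_loc_scale k (addl x y)).
rewrite (pi_loc_scale k x) (pi_loc_scale k y) -[RHS]pi_loc_add.
by congr \pi_loc; rewrite /scalel /addl /= scalerDr !scalerAl.
Qed.

Lemma loc_scaleDl x : {morph loc_scale^~ x : k l / k + l}.
Proof.
move=> k l; elim/quotW: x => x; rewrite !(pi_loc_scale _ x) -[RHS]pi_loc_add.
apply/eqP/loc_eqmodP; exists 1; rewrite ?rpred1 //= mul1r scalerDl.
by apply/eqP; rewrite subr_eq0; apply/eqP; ring.
Qed.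

HB.instance Definition _ := GRing.Zmodule_isLmodule.Build R loc
  loc_scaleA loc_scale1 loc_scaleDr loc_scaleDl.

Lemma locfracZ k (a d : A) (dD : d \in D) :
  k *: locfrac a dD = locfrac (k *: a) dD.
Proof. by rewrite /locfrac -[LHS]/(loc_scale _ _) pi_loc_scale. Qed.

Lemma loc_scalerAl k (x y : loc) : k *: (x * y) = (k *: x) * y.
Proof.
elim/quotW: x => x; elim/quotW: y => y.
rewrite -[X in k *: X]pi_loc_mul -[LHS]/(loc_scale _ _) pi_loc_scale.
rewrite -[X in X * _]/(loc_scale _ _) pi_loc_scale -[RHS]pi_loc_mul.
by congr \pi_loc; rewrite /scalel /mull /= scalerAl.
Qed.

End LocalizationModule.

Definition sigma_compact (X : topologicalType) (U : set X) : Prop :=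
  exists2 K : nat -> set X, (forall n, compact (K n)) & U = \bigcup_n K n.

Notation borelType X := (g_sigma_algebraType (@open X)).

(* Main.v *)
Require Import Defs.
From HB Require Import structures.
From mathcomp Require Import all_boot all_order all_algebra.
From mathcomp Require Import all_classical all_reals all_analysis.
From mathcomp Require Import measurable_realfun ring lra.
Import Order.TTheory GRing.Theory Num.Theory.
Import numFieldNormedType.Exports.
Local Open Scope classical_set_scope.
Local Open Scope ring_scope.

(** Write C_b(X) for the bounded continuous functions on X and Z(d) for the zero
    set of the function of d.  The measure comes from a positive functional I on
    C_b(X) that is squeezed by L: I g <= L (a/d) as soon as g <= a/d off Z(d),
    and I g >= L (a/d) as soon as g >= a/d off Z(d).

    The functional I.  For g in C_b(X) let p g be the infimum of L (a/d) over
    the fractions a/d that lie above g off Z(d).  It is finite because constants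
    are fractions, and sublinear because L is linear and positive; a product
    with d ^ 2 e ^ 2 turns an inequality a/d <= b/e off the zero sets into a
    sign condition on all of X, which is what positivity of L speaks about.  The
    Hahn-Banach theorem gives a linear I <= p (sandwiched_functional), and
    applying I <= p to g and to - g gives the squeeze.  The proper function q
    makes I tight: a function with values in [0, 1] that vanishes on {q <= k} is
    at most q/k, so its value under I is at most L(q)/k.

    The measure.  A tight positive functional on C_b(X) is countably subadditive
    by Dini's argument (tp_sigma_subadditive).  Hence Daniell's upper integral,
    the infimum of the sums of I (g n) over the countable covers of a function
    by nonnegative elements of C_b(X), extends I, and its values on indicators
    form an outer measure.  Cozero sets of continuous functions are Caratheodory
    measurable (cozero_caratheodory).  The space is locally compact, thus
    completely regular, so an open set that is a countable union of compact sets
    is also a countable union of cozero sets: all Borel sets are measurable.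
    The resulting measure mu integrates the nonnegative elements of C_b(X) to
    the values of I (riesz_tight).

    Fractions.  For a with nonnegative function, put
    g_n = n a / (n d ^ 2 + 1 + a).  The denominator never vanishes and g_n <= n,
    so g_n lies in C_b(X); off Z(d) it increases to a / d ^ 2, and
      a / d ^ 2 - a (1 + a) / (n d ^ 4) <= g_n <= a / d ^ 2.
    The two bounds are fractions, so I g_n tends to L (a / d ^ 2).  For a = 1
    the function g_n is n / 2 on Z(d) whereas its integral is at most
    L (1 / d ^ 2), so mu(Z(d)) = 0 (zero_set_negligible).  Monotone convergence off Z(d) then
    gives the integral formula for a / d ^ 2 (square_fraction_integral), and
    4 a / d = ((a + d) ^ 2 - (a - d) ^ 2) / d ^ 2 gives it for a / d. *)

(** * Linear functionals below a sublinear one *)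

Section hahn_banach.
Context {R : realType} {V : lmodType R} (S : set V).
Hypothesis SD : forall x y, S x -> S y -> S (x + y).
Hypothesis SZ : forall k x, S x -> S (k *: x).

(** Functionals are total functions constrained only on S, so that the theorem
    applies to a subspace of a function space without forming a subtype. *)
Definition sublinear_on (p : V -> R) :=
  (forall x y, S x -> S y -> p (x + y) <= p x + p y) /\
  (forall k x, 0 <= k -> S x -> p (k *: x) <= k * p x).

Let SN x : S x -> S (- x).
Proof. by move=> Sx; rewrite -scaleN1r; exact: SZ. Qed.

Lemma sublinear_on0 p x : sublinear_on p -> S x -> p 0 = 0.
Proof.
move=> [pD pZ] Sx; have S0 : S 0 by rewrite -(scale0r x); exact: SZ.
have := pD _ _ S0 S0; have := pZ 0 0 (lexx _) S0.
by rewrite scaler0 addr0 mul0r; lra.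
Qed.

Lemma sublinear_onZ p k x : sublinear_on p -> 0 <= k -> S x ->
  p (k *: x) = k * p x.
Proof.
move=> psub; rewrite le_eqVlt => /predU1P[<- Sx|k0 Sx].
  by rewrite scale0r mul0r (sublinear_on0 _ _ psub Sx).
have [pD pZ] := psub; apply/eqP; rewrite eq_le pZ ?(ltW k0)//=.
rewrite mulrC -ler_pdivlMr// mulrC.
rewrite -{1}(scale1r x) -(mulVf (lt0r_neq0 k0)) -scalerA.
by rewrite pZ ?invr_ge0 ?(ltW k0)//; exact: SZ.
Qed.

Lemma sublinear_on_lb p x y : sublinear_on p -> S x -> S y ->
  - p (- x) <= p (x + y) - p y.
Proof.
move=> psub Sx Sy; have := psub.1 (x + y) (- x) (SD _ _ Sx Sy) (SN _ Sx).
by rewrite addrAC subrr add0r; lra.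
Qed.

(** Zorn's lemma applies because the infimum of a chain of sublinear functionals
    is sublinear: of two members of the chain, the smaller one serves for both
    summands. *)
Lemma minimal_sublinear p : sublinear_on p -> exists q, [/\ sublinear_on q,
  forall x, S x -> q x <= p x &
  forall q', sublinear_on q' -> (forall x, S x -> q' x <= q x) ->
    forall x, S x -> q x <= q' x].
Proof.
move=> psub.
pose T := {q : V -> R | sublinear_on q /\ forall x, S x -> q x <= p x}.
pose ge_on (q r : T) := `[< forall x, S x -> sval r x <= sval q x >].
have p_self : sublinear_on p /\ forall x, S x -> p x <= p x by split.
have [||A Atot|[q [qsub qp]] qmin] := @ZL_preorder T (exist _ p p_self) ge_on.
- by move=> q; apply/asboolP.
- move=> r s t /asboolP rs /asboolP st; apply/asboolP => x Sx.
  exact: le_trans (st _ Sx) (rs _ Sx).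
- have [A0|/set0P[q0 Aq0]] := eqVneq A set0.
    by exists (exist _ p p_self) => s; rewrite A0.
  pose B x := [set sval s x | s in A].
  have Bne x : B x !=set0 by exists (sval q0 x); exists q0.
  have lbB x s : S x -> A s -> - p (- x) <= sval s x.
    move=> Sx _; case: s => s [ssub sp] /=.
    have S0 : S 0 by rewrite -(scale0r x); exact: SZ.
    have := sublinear_on_lb s x 0 ssub Sx S0.
    by rewrite (sublinear_on0 _ _ ssub Sx) addr0; have := sp _ (SN _ Sx); lra.
  have hB x : S x -> has_lbound (B x).
    by move=> Sx; exists (- p (- x)) => _ [s As <-]; exact: lbB.
  have infB x s : S x -> A s -> inf (B x) <= sval s x.
    by move=> Sx As; apply: ge_inf; [exact: hB|exists s].
  have qsub : sublinear_on (fun x => inf (B x)).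
    split=> [x y Sx Sy|k x k0 Sx].
      rewrite -lerBlDr; apply: lb_le_inf => // _ [s As <-].
      rewrite lerBlDr -lerBlDl; apply: lb_le_inf => // _ [t At <-].
      rewrite lerBlDl; have /orP[st|ts] : ge_on s t || ge_on t s.
          by apply/orP; exact: Atot.
        have := infB _ _ (SD _ _ Sx Sy) At; have := (svalP t).1.1 x y Sx Sy.
        by move/asboolP: st => /(_ _ Sx); lra.
      have := infB _ _ (SD _ _ Sx Sy) As; have := (svalP s).1.1 x y Sx Sy.
      by move/asboolP: ts => /(_ _ Sy); lra.
    move: k0; rewrite le_eqVlt => /predU1P[<-|k0].
      rewrite scale0r mul0r (le_trans (infB _ q0 _ Aq0))//.
        by rewrite -(scale0r x); exact: SZ.
      by rewrite (sublinear_on0 _ _ (svalP q0).1 Sx).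
    rewrite mulrC -ler_pdivrMr//; apply: lb_le_inf => // _ [s As <-].
    rewrite ler_pdivrMr// mulrC (le_trans (infB _ s _ As))//; first exact: SZ.
    by apply: (svalP s).1.2 => //; exact: ltW.
  have qp x : S x -> inf (B x) <= p x.
    by move=> Sx; exact: le_trans (infB _ _ Sx Aq0) ((svalP q0).2 _ Sx).
  have q_in : sublinear_on (fun x => inf (B x)) /\
    forall x, S x -> inf (B x) <= p x by split.
  exists (exist _ _ q_in : T) => s As; apply/asboolP => x Sx /=; exact: infB.
- exists q; split=> // q' q'sub q'q.
  have q'p x (Sx : S x) : q' x <= p x := le_trans (q'q _ Sx) (qp _ Sx).
  have q'_in : sublinear_on q' /\ forall x, S x -> q' x <= p x by split.
  by apply/asboolP/(qmin (exist _ q' q'_in : T))/asboolP.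
Qed.

(** The functional z |-> inf {q (z + t y) - t q y | 0 <= t} is sublinear and at
    most q, hence equal to q when q is minimal; t = 1 gives
    q x <= q (x + y) - q y. *)
Lemma minimal_sublinear_additive q : sublinear_on q ->
  (forall q', sublinear_on q' -> (forall x, S x -> q' x <= q x) ->
    forall x, S x -> q x <= q' x) ->
  forall x y, S x -> S y -> q (x + y) = q x + q y.
Proof.
move=> qsub qmin x y Sx Sy; apply/eqP; rewrite eq_le qsub.1//=.
pose B x := [set q (x + t *: y) - t * q y | t in [set t | 0 <= t]].
have infB z t : S z -> 0 <= t -> inf (B z) <= q (z + t *: y) - t * q y.
  move=> Sz t0; apply: ge_inf; last by exists t.
  exists (- q (- z)) => _ [s /= s0 <-].
  rewrite -(sublinear_onZ q)//; apply: sublinear_on_lb => //; exact: SZ.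
have Bne z : B z !=set0 by exists (q (z + 0 *: y) - 0 * q y); exists 0 => /=.
have q'sub : sublinear_on (fun z => inf (B z)).
  split=> [u v Su Sv|k u k0 Su].
    rewrite -lerBlDr; apply: lb_le_inf => // _ [s /= s0 <-].
    rewrite lerBlDr -lerBlDl; apply: lb_le_inf => // _ [t /= t0 <-].
    have := infB _ (s + t) (SD _ _ Su Sv) (addr_ge0 s0 t0).
    rewrite lerBlDl => /le_trans; apply.
    rewrite scalerDl addrACA mulrDl.
    have := qsub.1 (u + s *: y) (v + t *: y)
      (SD _ _ Su (SZ s _ Sy)) (SD _ _ Sv (SZ t _ Sy)).
    lra.
  move: k0; rewrite le_eqVlt => /predU1P[<-|k0].
    rewrite scale0r mul0r (le_trans (infB _ 0 _ _))//.
      by rewrite -(scale0r y); exact: SZ.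
    by rewrite scale0r mul0r addr0 subr0 (sublinear_on0 _ _ qsub Sy).
  rewrite mulrC -ler_pdivrMr//; apply: lb_le_inf => // _ [t /= t0 <-].
  rewrite ler_pdivrMr// mulrC (le_trans (infB _ (k * t) (SZ k _ Su) _))//.
    by rewrite mulr_ge0// ltW.
  rewrite -scalerA -scalerDr mulrBr mulrA lerB// qsub.2 ?(ltW k0)//.
  by apply: SD => //; exact: SZ.
have q'q z : S z -> inf (B z) <= q z.
  by move=> Sz; rewrite (le_trans (infB z 0 Sz _))// scale0r mul0r addr0 subr0.
rewrite -lerBrDr (le_trans (qmin _ q'sub q'q _ Sx))//.
by have := infB x 1 Sx ler01; rewrite scale1r mul1r.
Qed.

Theorem hahn_banach p : sublinear_on p -> exists I : V -> R,
  [/\ forall x y, S x -> S y -> I (x + y) = I x + I y,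
      forall k x, S x -> I (k *: x) = k * I x &
      forall x, S x -> I x <= p x].
Proof.
move=> /minimal_sublinear[I [Isub Ip Imin]].
have ID := minimal_sublinear_additive _ Isub Imin.
exists I; split=> // k x Sx; have [k0|k0] := leP 0 k.
  exact: sublinear_onZ.
have SNk : S ((- k) *: x) by exact: SZ.
have /eqP := ID _ _ (SZ k _ Sx) SNk.
rewrite -scalerDl subrr scale0r (sublinear_on0 _ _ Isub Sx).
rewrite (sublinear_onZ I (- k)) ?oppr_ge0 ?(ltW k0)//.
by rewrite mulNr eq_sym subr_eq0 => /eqP.
Qed.

End hahn_banach.

(** * Tight positive functionals on bounded continuous functions *)

Section bounded_continuous.
Context {R : realType} {X : ptopologicalType}.
Implicit Types f g : X -> R.

Definition bcont f := continuous f /\ exists M, forall x, `|f x| <= M.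

Lemma bcont_cst (c : R) : bcont (fun=> c).
Proof. by split; [exact: cst_continuous|exists `|c|]. Qed.

Lemma bcontD f g : bcont f -> bcont g -> bcont (fun x => f x + g x).
Proof.
move=> [cf [M fM]] [cg [N gN]]; split.
  by move=> x; exact: (cvgD (cf x) (cg x)).
by exists (M + N) => x; rewrite (le_trans (ler_normD _ _))// lerD.
Qed.

Lemma bcontM f g : bcont f -> bcont g -> bcont (fun x => f x * g x).
Proof.
move=> [cf [M fM]] [cg [N gN]]; split.
  by move=> x; exact: (cvgM (cf x) (cg x)).
by exists (M * N) => x; rewrite normrM ler_pM.
Qed.

Lemma bcontZ (k : R) f : bcont f -> bcont (fun x => k * f x).
Proof. exact/bcontM/bcont_cst. Qed.

Lemma bcontB f g : bcont f -> bcont g -> bcont (fun x => f x - g x).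
Proof.
move=> bf /(bcontZ (-1)) bg; have := bcontD _ _ bf bg.
by congr bcont; apply/funext => x /=; rewrite mulN1r.
Qed.

Lemma bcont_min f g : bcont f -> bcont g ->
  bcont (fun x => Num.min (f x) (g x)).
Proof.
move=> [cf [M fM]] [cg [N gN]]; split.
  by move=> x; exact: (continuous_min (cf x) (cg x)).
exists (M + N) => x; have := fM x; have := gN x.
have := normr_ge0 (f x); have := normr_ge0 (g x).
by case: (leP (f x) (g x)) => _; lra.
Qed.

Lemma bcont_max f g : bcont f -> bcont g ->
  bcont (fun x => Num.max (f x) (g x)).
Proof.
move=> [cf [M fM]] [cg [N gN]]; split.
  by move=> x; exact: (continuous_max (cf x) (cg x)).
exists (M + N) => x; have := fM x; have := gN x.
have := normr_ge0 (f x); have := normr_ge0 (g x).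
by case: (leP (f x) (g x)) => _; lra.
Qed.

Lemma bcont_sum (g : nat -> X -> R) n :
  (forall i, bcont (g i)) -> bcont (fun x => \sum_(i < n) g i x).
Proof.
move=> bg; elim: n => [|n IHn].
  by under eq_fun do rewrite big_ord0; exact: bcont_cst.
by under eq_fun do rewrite big_ord_recr /=; exact: bcontD.
Qed.

End bounded_continuous.

(** Without compactness of X, positivity alone does not make a functional on
    C_b(X) countably subadditive: mass may escape to infinity.  The last clause
    excludes this. *)
Record tight_positive {R : realType} {X : ptopologicalType}
    (I : (X -> R) -> R) : Prop := TightPositive {
  tpD : forall f g, bcont f -> bcont g -> I (fun x => f x + g x) = I f + I g;
  tpZ : forall k f, bcont f -> I (fun x => k * f x) = k * I f;
  tp_ge0 : forall f, bcont f -> (forall x, 0 <= f x) -> 0 <= I f;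
  tp_tight : forall e, 0 < e -> exists2 K : set X, compact K &
    forall g, bcont g -> (forall x, 0 <= g x <= 1) ->
      (forall x, K x -> g x = 0) -> I g <= e }.

Section tight_positive_theory.
Context {R : realType} {X : ptopologicalType} {I : (X -> R) -> R}.
Hypothesis Itp : tight_positive I.
Implicit Types f g : X -> R.

Lemma tpB f g : bcont f -> bcont g -> I (fun x => f x - g x) = I f - I g.
Proof.
move=> bf bg; rewrite -mulN1r -(tpZ _ Itp)// -(tpD _ Itp)//; last exact: bcontZ.
by congr I; apply/funext => x; rewrite mulN1r.
Qed.

Lemma tp_le f g : bcont f -> bcont g -> (forall x, f x <= g x) -> I f <= I g.
Proof.
move=> bf bg fg; rewrite -subr_ge0 -tpB//; apply: (tp_ge0 _ Itp).
  exact: bcontB.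
by move=> x; rewrite subr_ge0.
Qed.

Lemma tp_cst c : I (fun=> c) = c * I (fun=> 1).
Proof.
rewrite -(tpZ _ Itp); last exact: bcont_cst.
by congr I; apply/funext => x; rewrite mulr1.
Qed.

Lemma tp_sum (g : nat -> X -> R) n : (forall i, bcont (g i)) ->
  I (fun x => \sum_(i < n) g i x) = \sum_(i < n) I (g i).
Proof.
move=> bg; elim: n => [|n IHn].
  transitivity (0 * I (fun=> 1)); last by rewrite mul0r big_ord0.
  by rewrite -tp_cst; congr I; apply/funext => x; rewrite big_ord0.
rewrite big_ord_recr /= -IHn -(tpD _ Itp)//; last exact: bcont_sum.
by congr I; apply/funext => x; rewrite big_ord_recr.
Qed.

Lemma tp1_ge0 : 0 <= I (fun=> 1).
Proof. by apply: (tp_ge0 _ Itp) => //; exact: bcont_cst. Qed.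

End tight_positive_theory.

Lemma partial_sum_gt {R : realType} (u : nat -> R) (r : R) :
  (forall n, 0 <= u n) -> (r%:E < \sum_(n <oo) (u n)%:E)%E ->
  exists n, r < \sum_(i < n) u i.
Proof.
move=> u0; apply: contraPP => /forallNP small; apply/negP; rewrite -leNgt.
apply: lime_le; first by apply: is_cvg_nneseries => n _ _; rewrite lee_fin u0.
apply: nearW => n; rewrite big_mkord sumEFin lee_fin leNgt; apply/negP.
exact: small.
Qed.

Lemma sum_le_mono {R : realType} (u : nat -> R) m n :
  (forall n, 0 <= u n) -> (m <= n)%N -> \sum_(i < m) u i <= \sum_(i < n) u i.
Proof.
move=> u0 mn; rewrite -!(big_mkord xpredT u) (big_cat_nat _ mn)//= lerDl.
exact: sumr_ge0.
Qed.

(** Dini's argument: on a compact set the inequality holds for a partial sum up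
    to a small error, and tightness absorbs what happens elsewhere. *)
Lemma tp_sigma_subadditive {R : realType} {X : ptopologicalType}
    (I : (X -> R) -> R) (f : X -> R) (g : nat -> X -> R) :
  tight_positive I -> bcont f -> (forall n, bcont (g n)) ->
  (forall n x, 0 <= g n x) ->
  (forall x, (f x)%:E <= \sum_(n <oo) (g n x)%:E)%E ->
  ((I f)%:E <= \sum_(n <oo) (I (g n))%:E)%E.
Proof.
move=> Itp bf bg g0 fg; apply/lee_addgt0Pr => e e0.
have [cf [M0 fM0]] := bf; pose M := `|M0| + 1.
have M_gt0 : 0 < M by rewrite ltr_wpDl.
have fM x : f x <= M.
  by rewrite (le_trans (ler_norm _))// (le_trans (fM0 x))// ler_wpDr// ler_norm.
have I1 := tp1_ge0 Itp; set c := I (fun=> 1) in I1.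
pose d := e / (2 * (c + 1)).
have d0 : 0 < d by rewrite divr_gt0// mulr_gt0// ltr_wpDl.
have e2M : 0 < e / (2 * M) by rewrite divr_gt0// mulr_gt0.
have [K cK tightK] := tp_tight _ Itp _ e2M.
have [n Kn] : exists n, forall x, K x -> f x - d < \sum_(i < n) g i x.
  pose U n := [set x | f x - d < \sum_(i < n) g i x].
  have oU n : open (U n).
    have -> : U n = (fun x => \sum_(i < n) g i x - f x) @^-1` [set y | - d < y].
      by apply/seteqP; split=> x; rewrite /U/=; lra.
    apply: open_comp; last exact: open_gt.
    by move=> x _; apply: (bcontB _ _ (bcont_sum _ n bg) bf).1.
  move: cK; rewrite compact_cover => /(_ nat setT U (fun n _ => oU n)).
  have UK : K `<=` cover setT U.
    move=> x _; have [||n fn] := @partial_sum_gt R (g ^~ x) (f x - d).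
    - by move=> n; exact: g0.
    - by rewrite (lt_le_trans _ (fg x))// lte_fin; lra.
    by exists n.
  move=> /(_ UK)[D _ DK]; exists (\max_(m <- finmap.enum_fset D) m)%N.
  move=> x /DK[m /= mD xm]; apply: (lt_le_trans xm).
  apply: (sum_le_mono (g^~ x)) => [i|]; first exact: g0.
  exact: (leq_bigmax_seq _ mD).
pose s x := \sum_(i < n) g i x.
have bs : bcont s by exact: bcont_sum.
have bsd : bcont (fun x => s x + d) by apply: bcontD => //; exact: bcont_cst.
have s0 x : 0 <= s x by apply: sumr_ge0 => i _; exact: g0.
(* the part of f that the partial sum misses, scaled into [0, 1] *)
pose h x := M^-1 * Num.max (f x - (s x + d)) 0.
have bh : bcont h.
  by apply/bcontZ/bcont_max; [exact: bcontB|exact: bcont_cst].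
have h01 x : 0 <= h x <= 1.
  rewrite /h mulr_ge0 ?invr_ge0 ?(ltW M_gt0) ?le_max ?lexx ?orbT//=.
  rewrite mulrC ler_pdivrMr// mul1r ge_max (ltW M_gt0) andbT.
  by have := fM x; have := s0 x; lra.
have hK x : K x -> h x = 0.
  move=> /Kn; rewrite -/(s x) => fs.
  by rewrite /h (_ : Num.max _ _ = 0) ?mulr0//; apply/max_idPr; lra.
have fsh : I f <= I s + d * c + M * I h.
  rewrite -tp_cst// -(tpZ _ Itp)// -(tpD _ Itp)//; last exact: bcont_cst.
  rewrite -(tpD _ Itp)//; last exact: bcontZ.
  apply: (tp_le Itp) => //; first by apply: bcontD => //; exact: bcontZ.
  move=> x; rewrite /h mulVKf ?gt_eqF//.
  by case: (leP (f x - (s x + d)) 0); lra.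
rewrite (@le_trans _ _ (I s + e)%:E)//.
  rewrite lee_fin (le_trans fsh)// -addrA lerD2l [leRHS](splitr e) lerD//.
    rewrite /d mulrAC ler_pdivrMr ?mulr_gt0 ?ltr_wpDl//.
    have -> : e / 2 * (2 * (c + 1)) = e * (c + 1) by field.
    by rewrite ler_wpM2l ?(ltW e0)//; lra.
  rewrite (le_trans (ler_wpM2l (ltW M_gt0) (tightK _ bh h01 hK)))//.
  have -> // : M * (e / (2 * M)) = e / 2 by field; rewrite gt_eqF.
rewrite EFinD leeD2r// /s tp_sum// -sumEFin.
rewrite -(big_mkord xpredT (fun i => (I (g i))%:E)).
apply: nneseries_lim_ge => k _ _; rewrite lee_fin (tp_ge0 _ Itp)//.
Qed.

(** * Daniell's upper integral *)

Lemma nneseries_pair (R : realType) : exists f : nat -> nat * nat,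
  forall G : nat * nat -> \bar R, (forall p, 0 <= G p)%E ->
    (\sum_(n <oo) G (f n) = \sum_(i <oo) \sum_(j <oo) G (i, j))%E.
Proof.
have /card_esym/ppcard_eqP[f] := card_nat2; exists f => G G0.
rewrite nneseries_esumT//.
rewrite -(reindex_esum setT setT f G)//.
rewrite nneseries_esumT; last by move=> i; exact: nneseries_ge0.
rewrite (eq_esum (b := fun i => \esum_(j in setT) G (i, j))); last first.
  by move=> i _; rewrite nneseries_esumT.
rewrite esum_esum// (_ : _ `*`` _ = setT); last by apply/seteqP; split.
by apply: eq_esum => -[].
Qed.

Lemma nneseries1 (R : realType) (u : nat -> \bar R) :
  (forall n, (0 < n)%N -> u n = 0%E) -> (\sum_(n <oo) u n = u 0%N)%E.
Proof.
move=> u0; apply/cvg_lim => //; rewrite -(cvg_shiftn 1).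
apply: cvg_near_cst; apply: nearW => n.
rewrite /= addn1 big_nat_recl// big1 ?adde0//.
by move=> i _; exact: u0.
Qed.

Section upper_integral.
Context {R : realType} {X : ptopologicalType} (I : (X -> R) -> R).
Hypothesis Itp : tight_positive I.
Implicit Types (f h : X -> R) (g : nat -> X -> R).
Local Open Scope ereal_scope.

Definition upper_cover h g := [/\ forall n, bcont (g n),
  forall n x, (0 <= g n x)%R & forall x, (h x)%:E <= \sum_(n <oo) (g n x)%:E].

(** Daniell's upper integral; its values on indicators form the outer measure
    behind the representing measure. *)
Definition upper h :=
  ereal_inf [set \sum_(n <oo) (I (g n))%:E | g in [set g | upper_cover h g]].

Let I_ge0 h g n : upper_cover h g -> 0 <= (I (g n))%:E.
Proof. by case=> bg g0 _; rewrite lee_fin (tp_ge0 _ Itp). Qed.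

Lemma upper_ge0 h : 0 <= upper h.
Proof.
apply: le_ereal_inf_tmp => _ [g hg <-]; apply: nneseries_ge0 => n _ _.
exact: I_ge0 hg.
Qed.

Lemma le_upper h1 h2 : (forall x, (h1 x <= h2 x)%R) -> upper h1 <= upper h2.
Proof.
move=> h12; apply: le_ereal_inf_tmp => _ [g [bg g0 hg] <-].
apply: ereal_inf_lbound; exists g => //; split=> // x.
by rewrite (le_trans _ (hg x))// lee_fin.
Qed.

(** The lower bound on the covers of f is countable subadditivity of I. *)
Lemma upper_bcont f : bcont f -> (forall x, (0 <= f x)%R) -> upper f = (I f)%:E.
Proof.
move=> bf f0; apply/eqP; rewrite eq_le; apply/andP; split; last first.
  apply: le_ereal_inf_tmp => _ [g [bg g0 fg] <-].
  exact: tp_sigma_subadditive.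
have I0 : I (fun=> 0%R) = 0%R.
  by have := tp_cst Itp 0%R; rewrite mul0r.
apply: ereal_inf_lbound; exists (fun n => if n is 0%N then f else fun=> 0%R).
  split=> [[|n]//|[|n]//|x]; first exact: bcont_cst.
  by rewrite nneseries1//; case.
by rewrite nneseries1//; case=> // n _; rewrite I0.
Qed.

Lemma upper_sigma_subadditive h (H : nat -> X -> R) :
  (forall k x, (0 <= H k x)%R) ->
  (forall x, (h x)%:E <= \sum_(k <oo) (H k x)%:E) ->
  upper h <= \sum_(k <oo) upper (H k).
Proof.
move=> H0 hH.
have [[i ioo]|/forallNP Hoo] := pselect (exists i, upper (H i) = +oo).
  rewrite (eseries_pinfty _ _ ioo) ?leey// => n _.
  by rewrite -ltNye (lt_le_trans _ (upper_ge0 _)).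
apply/lee_addgt0Pr => e e0.
rewrite (le_trans _ (epsilon_trick _ _ (ltW e0)))//; last first.
  by move=> n; exact: upper_ge0.
pose P n g := upper_cover (H n) g /\
  \sum_(k <oo) (I (g k))%:E <= upper (H n) + (e / (2 ^ n.+1)%:R)%:E.
have [G PG] : {G & forall n, P n (G n)}.
  apply: (@choice _ _ P) => n.
  have en : (0 < e / (2 ^ n.+1)%:R)%R by rewrite divr_gt0// ltr0n expn_gt0.
  have /(lb_ereal_inf_adherent en) [_ [g Hg <-] /ltW le_e] :
      upper (H n) \is a fin_num.
    by rewrite ge0_fin_numE ?upper_ge0// ltey; exact/eqP/Hoo.
  by exists g.
have [f sumf] := nneseries_pair R.
have G0 n k x : (0 <= G n k x)%R by have [[]] := PG n.
apply: (@le_trans _ _ (\sum_(n <oo) (I (G (f n).1 (f n).2))%:E)).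
  apply: ereal_inf_lbound.
  exists (fun n => G (f n).1 (f n).2) => //; split=> //.
    by move=> n; have [[]] := PG (f n).1.
  move=> x; rewrite (sumf (fun p => (G p.1 p.2 x)%:E)); last first.
    by move=> p; rewrite lee_fin.
  rewrite (le_trans (hH x))//.
  apply: lee_nneseries => [k _ _|k _]; first by rewrite lee_fin.
  by have [[_ _]] := PG k.
rewrite (sumf (fun p => (I (G p.1 p.2))%:E)); last first.
  by move=> p; exact: I_ge0 (PG p.1).1.
apply: lee_nneseries => [n _ _|n _]; last exact: (PG n).2.
by apply: nneseries_ge0 => k _ _; exact: I_ge0 (PG n).1.
Qed.

(** A cover g of h splits into the covers g u of h u and g (1 - u) of h (1 - u),
    on which I adds up: bounded continuous functions may multiply. *)
Lemma upper_split h u : bcont u -> (forall x, (0 <= u x <= 1)%R) ->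
  upper (fun x => h x * u x)%R + upper (fun x => h x * (1 - u x))%R <= upper h.
Proof.
move=> bu u01; apply: le_ereal_inf_tmp => _ [g [bg g0 hg] <-].
have u0 x : (0 <= u x)%R by have /andP[] := u01 x.
have v0 x : (0 <= 1 - u x)%R by rewrite subr_ge0; have /andP[] := u01 x.
have bv : bcont (fun x => 1 - u x)%R by apply: bcontB => //; exact: bcont_cst.
have coverM w : bcont w -> (forall x, (0 <= w x)%R) ->
    upper_cover (fun x => h x * w x)%R (fun n x => g n x * w x)%R.
  move=> bw w0; split=> [n|n x|x]; first exact: bcontM.
    exact: mulr_ge0.
  rewrite mulrC EFinM; under eq_eseriesr do rewrite mulrC EFinM.
  rewrite nneseriesZl; last by move=> n _; rewrite lee_fin.
  by rewrite lee_wpmul2l// lee_fin.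
rewrite [leRHS](_ : _ = \sum_(n <oo) (I (fun x => g n x * u x)%R)%:E +
    \sum_(n <oo) (I (fun x => g n x * (1 - u x))%R)%:E).
  by apply: leeD; apply: ereal_inf_lbound;
    [exists (fun n x => g n x * u x)%R|
     exists (fun n x => g n x * (1 - u x))%R] => //; exact: coverM.
rewrite -nneseriesD.
- apply: eq_eseriesr => n _; rewrite -EFinD -(tpD _ Itp); [|exact: bcontM..].
  by congr (I _)%:E; apply/funext => x; ring.
- by move=> n _ _; exact: I_ge0 (coverM _ bu u0).
- by move=> n _ _; exact: I_ge0 (coverM _ bv v0).
Qed.

End upper_integral.

(** * The outer measure and its measurable sets *)

Section daniell_outer_measure.
Context {R : realType} {X : ptopologicalType} (I : (X -> R) -> R).
Hypothesis Itp : tight_positive I.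
Local Open Scope ereal_scope.

Definition daniell (E : set X) : \bar R := upper I \1_E.

Let indic_ge0 (E : set X) x : (0 <= \1_E x :> R)%R.
Proof. by rewrite indicE. Qed.

Lemma indic_le (E F : set X) x : E `<=` F -> (\1_E x <= \1_F x :> R)%R.
Proof.
move=> EF; rewrite !indicE; have [/set_mem/EF Fx|//] := boolP (x \in E).
by rewrite (mem_set Fx).
Qed.

Lemma daniell0 : daniell set0 = 0.
Proof.
rewrite /daniell indic0 upper_bcont//; last exact: bcont_cst.
by rewrite (tp_cst Itp) mul0r.
Qed.

Lemma daniellT : daniell setT = (I (fun=> 1%R))%:E.
Proof. by rewrite /daniell indicT upper_bcont//; exact: bcont_cst. Qed.

Lemma daniell_sigma_subadditive : sigma_subadditive daniell.
Proof.
move=> F; apply: upper_sigma_subadditive => // x.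
rewrite indicE; have [/set_mem[k _ Fkx]|_] := boolP (x \in _).
  apply: (le_trans _ (nneseries_lim_ge k.+1 _)) => [|i _ _]; last first.
    by rewrite lee_fin.
  rewrite big_nat_recr//= indicE mem_set// leeDr//.
  by apply: sume_ge0 => i _; rewrite lee_fin.
by apply: nneseries_ge0 => k _ _; rewrite lee_fin.
Qed.

Definition daniell_isOuterMeasure := isOuterMeasure.Build R X daniell
  daniell0 (fun E => upper_ge0 I Itp \1_E)
  (fun E F EF => le_upper I _ _ (fun x => indic_le E F x EF))
  daniell_sigma_subadditive.

Definition daniell_outer : {outer_measure set X -> \bar R} :=
  HB.pack daniell daniell_isOuterMeasure.

Lemma geometric_series_cover (t : R) : (0 < t <= 1)%R ->
  \sum_(k <oo) ((1 - t) ^+ k * t)%:E = 1.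
Proof.
move=> /andP[t0 t1]; apply/cvg_lim => //.
have -> : (fun n => \sum_(0 <= k < n) ((1 - t) ^+ k * t)%:E) =
    (fun n => (1 - (1 - t) ^+ n)%:E).
  apply/funext; elim=> [|n IHn]; first by rewrite big_geq// expr0 subrr.
  by rewrite big_nat_recr//= IHn -EFinD exprS; congr EFin; ring.
apply: cvg_EFin; first exact: nearW.
rewrite -[X in _ --> X]subr0; apply: cvgB; first exact: cvg_cst.
by apply: cvg_expr; rewrite ger0_norm; lra.
Qed.

(** Cut a test set Y by the functions (1 - f)^n f, whose sum is the indicator of
    the cozero set: each is split off from the preceding remainder, as a factor,
    so that no approximation of the cozero set from inside is needed. *)
Lemma cozero_caratheodory (f : X -> R) : bcont f ->
  (forall x, (0 <= f x <= 1)%R) ->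
  daniell_outer.-caratheodory [set x | (0 < f x)%R].
Proof.
move=> bf f01; apply: le_caratheodory_measurable => Y.
set A := [set x | _].
change (daniell (Y `&` A) + daniell (Y `&` ~` A) <= daniell Y).
pose h n (x : X) : R := (\1_Y x * (1 - f x) ^+ n)%R.
have h0 n x : (0 <= h n x)%R.
  by rewrite mulr_ge0// exprn_ge0//; have := f01 x; lra.
have rest n : \sum_(0 <= k < n) upper I (fun x => h k x * f x)%R +
    upper I (h n) <= daniell Y.
  elim: n => [|n].
    by rewrite big_geq// add0e le_upper// => x; rewrite /h expr0 mulr1.
  apply: le_trans; rewrite big_nat_recr//= -addeA leeD2l//.
  have -> : h n.+1 = (fun x => h n x * (1 - f x))%R.
    by apply/funext => x; rewrite /h exprSr mulrA.
  exact: upper_split.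
(* finiteness makes the subtraction of this value reversible *)
have YfinE : daniell (Y `&` ~` A) \is a fin_num.
  rewrite ge0_fin_numE ?upper_ge0//.
  rewrite (@le_lt_trans _ _ (daniell setT))//; last by rewrite daniellT ltry.
  by apply: le_upper => x; exact: indic_le.
rewrite -leeBrDr//.
apply: (@le_trans _ _ (\sum_(k <oo) upper I (fun x => h k x * f x)%R)).
  apply: upper_sigma_subadditive => // [k x|x].
    by rewrite mulr_ge0//; have := f01 x; lra.
  rewrite indicE; have [/set_mem[Yx Ax]|_] := boolP (x \in _); last first.
    apply: nneseries_ge0 => k _ _; rewrite lee_fin mulr_ge0//.
    by have := f01 x; lra.
  rewrite -(geometric_series_cover (f x)).
    apply: lee_nneseries => [k _ _|k _]; rewrite lee_fin.
      by rewrite mulr_ge0 ?exprn_ge0//; have := f01 x; lra.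
    by rewrite /h indicE mem_set// mul1r.
  by have := f01 x; rewrite /A/= in Ax; lra.
apply: lime_le.
  by apply: is_cvg_nneseries => k _ _; exact: upper_ge0.
apply: nearW => n; rewrite leeBrDr// (le_trans _ (rest n))// leeD2l//.
apply: le_upper => x; rewrite /h !indicE.
have [/set_mem[Yx /negP]|_] := boolP (x \in Y `&` ~` A); last exact: h0.
rewrite -leNgt => fx0; rewrite mem_set//.
have -> : f x = 0%R by have := f01 x; lra.
by rewrite subr0 expr1n mulr1.
Qed.

End daniell_outer_measure.

Lemma caratheodory_open_measure {R : realType} {X : ptopologicalType}
    (mu : {outer_measure set X -> \bar R}) :
  (forall U : set X, open U -> mu.-caratheodory U) ->
  exists nu : {measure set (borelType X) -> \bar R}, forall E, nu E = mu E.
Proof.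
move=> muo.
have mE (E : set (borelType X)) : measurable E -> mu.-caratheodory E.
  apply: (@smallest_sub _ _ _ (measurable : set (set (caratheodory_type mu)))).
    exact: sigma_algebra_measurable.
  exact: muo.
have mu_add : semi_sigma_additive (mu : set (borelType X) -> \bar R).
  move=> F mF tF mUF.
  by apply: caratheodory_measure_sigma_additive => // [i|]; exact: mE.
pose m := isMeasure.Build _ _ _ (mu : set (borelType X) -> \bar R)
  (outer_measure0 mu) (outer_measure_ge0 mu) mu_add.
by exists (HB.pack_for {measure set (borelType X) -> \bar R}
  (mu : set (borelType X) -> \bar R) m).
Qed.

(** * Representation of tight functionals by Borel measures *)

Definition cozero_covered {R : realType} {X : ptopologicalType} (U : set X) :=
  exists f : nat -> X -> R, [/\ forall n, bcont (f n),
    forall n x, 0 <= f n x <= 1 & U = \bigcup_n [set x | 0 < f n x]].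

Lemma borel_measurable_fun {R : realType} {X : ptopologicalType} (f : X -> R) :
  continuous f -> measurable_fun [set: borelType X] (f : borelType X -> R).
Proof.
move=> /continuousP cf; apply: (measurability _ (RGenOpens.measurableE R)).
move=> _ [_ [a [b ->] <-]]; rewrite setTI.
apply: sub_sigma_algebra; apply: cf; exact: interval_open.
Qed.

Lemma layerP {R : realType} (y t s : R) : 0 < s ->
  let p := Num.min y (t + s) - Num.min y t in
  [/\ 0 <= p, p <= s, y <= t -> p = 0 & t + s < y -> p = s].
Proof.
move=> s0 /=; case: (leP y t) => yt.
  by case: (leP y (t + s)) => yts; split; lra.
by case: (leP y (t + s)) => yts; split; lra.
Qed.

Section representation.
Context {R : realType} {X : ptopologicalType} (I : (X -> R) -> R).
Hypothesis Itp : tight_positive I.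
Variable nu : {measure set (borelType X) -> \bar R}.
Hypothesis nuE : forall E, nu E = daniell I E.
Implicit Types f : X -> R.

Let mf f : bcont f -> measurable_fun [set: borelType X] (fun x => (f x)%:E).
Proof.
by move=> [cf _]; apply/measurable_EFinP; exact: borel_measurable_fun.
Qed.

(** Cut f at the heights j / (n + 1) into layers.  The layer psi j lies between
    1 / (n + 1) times the indicators of {f > (j + 1) / (n + 1)} and of
    {f > j / (n + 1)}, so the integral of each layer is at most the value of I
    on the layer just below; only the lowest one, of integral at most
    I 1 / (n + 1), has none below it. *)
Lemma layer_integral_le f : bcont f -> (forall x, 0 <= f x <= 1) -> forall n,
  (\int[nu]_x (f x)%:E <= (I f + n.+1%:R^-1 * I (fun=> 1%R))%:E)%E.
Proof.
move=> bf f01 n; pose N : R := n.+1%:R.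
have N0 : 0 < N by rewrite ltr0n.
pose u j x := Num.min (f x) (j%:R / N).
pose psi j x := u j.+1 x - u j x.
pose E j : set (borelType X) := [set x | j%:R / N < f x].
have bu j : bcont (u j) by apply: bcont_min => //; exact: bcont_cst.
have bpsi j : bcont (psi j) by exact: bcontB.
have jN j : j.+1%:R / N = j%:R / N + N^-1 by rewrite -addn1 natrD mulrDl mul1r.
have iN0 : 0 < N^-1 by rewrite invr_gt0.
have psi_layer j x : [/\ 0 <= psi j x, psi j x <= N^-1,
    f x <= j%:R / N -> psi j x = 0 & j%:R / N + N^-1 < f x -> psi j x = N^-1].
  by rewrite /psi /u jN; exact: layerP.
have psi0 j x : 0 <= psi j x by have [] := psi_layer j x.
have psiE j x : psi j x <= N^-1 * \1_(E j) x.
  have [_ ps p0 _] := psi_layer j x.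
  rewrite indicE; have [_|] := boolP (x \in E j); first by rewrite mulr1.
  by move=> /negP nEx; rewrite mulr0 p0// leNgt; apply/negP => /mem_set.
have Epsi j x : \1_(E j.+1) x <= N * psi j x.
  rewrite indicE; have [/set_mem|_] := boolP (x \in E j.+1); last first.
    by rewrite mulr_ge0// ltW.
  have [_ _ _ ps] := psi_layer j x.
  by rewrite /E/= jN => /ps ->; rewrite mulfV ?gt_eqF.
have fpsi x : f x = \sum_(j < n.+1) psi j x.
  rewrite -(big_mkord xpredT (psi^~ x)) /psi (telescope_sumr (u^~ x))// /u.
  have := f01 x; rewrite mul0r mulfV ?gt_eqF//.
  by case: (leP (f x) 1) => ?; case: (leP (f x) 0) => ?; lra.
have oE j : measurable (E j).
  apply: sub_sigma_algebra.
  rewrite (_ : E j = f @^-1` [set y | j%:R / N < y])//.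
  by apply: open_comp => [x _|]; [exact: bf.1|exact: open_gt].
have int_psi j : (\int[nu]_x (psi j x)%:E <= N^-1%:E * nu (E j))%E.
  apply: (@le_trans _ _ (\int[nu]_x (N^-1 * \1_(E j) x)%:E)%E).
    apply: ge0_le_integral => //.
    - by move=> x _; rewrite lee_fin.
    - exact: mf.
    - by apply/measurable_EFinP; apply: measurable_funM.
    - by move=> x _; rewrite lee_fin.
  rewrite (integralZl_indic measurableT (fun=> E j))//; last first.
    by move=> neg; move: iN0; rewrite ltNge (ltW neg).
  by rewrite integral_indic// setIT.
have nuE1 j : (N^-1%:E * nu (E j.+1) <= (I (psi j))%:E)%E.
  rewrite nuE -lee_pdivlMl// invrK -EFinM -(tpZ _ Itp)//.
  rewrite -upper_bcont//; first exact: le_upper.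
  - exact: bcontZ.
  - by move=> x; rewrite mulr_ge0// ltW.
rewrite (eq_integral
  (fun x : borelType X => (\sum_(j < n.+1) (psi j x)%:E)%E)); last first.
  by move=> x _; rewrite sumEFin fpsi.
rewrite ge0_integral_sum//; last 2 first.
- by move=> j; exact: mf.
- by move=> j x _; rewrite lee_fin.
apply: (@le_trans _ _ (\sum_(j < n.+1) (N^-1%:E * nu (E j)))%E).
  by apply: lee_sum => j _; exact: int_psi.
rewrite big_ord_recl /= addrC EFinD; apply: leeD.
  apply: (@le_trans _ _ (\sum_(j < n) (I (psi j))%:E)%E).
    by apply: lee_sum => j _; rewrite nuE1.
  rewrite sumEFin lee_fin -tp_sum//; apply: (tp_le Itp) => //.
    exact: bcont_sum.
  by move=> x; rewrite fpsi big_ord_recr/= lerDl.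
rewrite EFinM lee_pmul2l// -daniellT// nuE.
by apply: le_upper => x; exact: indic_le.
Qed.

Lemma integral_le_tp f : bcont f -> (forall x, 0 <= f x <= 1) ->
  (\int[nu]_x (f x)%:E <= (I f)%:E)%E.
Proof.
move=> bf f01; apply/lee_addgt0Pr => e e0.
have c0 := tp1_ge0 Itp; set c := I _ in c0.
have [n en] : exists n, n.+1%:R^-1 * c <= e.
  exists (Num.truncn (c / e)).
  rewrite mulrC ler_pdivrMr// -ler_pdivrMl// mulrC ltW//.
  by rewrite truncnS_gt.
by rewrite (le_trans (layer_integral_le f bf f01 n))// -EFinD lee_fin lerD2l.
Qed.

(** The inequality for 1 - f is the reverse inequality for f, since the measure
    of the whole space is I 1. *)
Theorem integral_tp f : bcont f -> (forall x, 0 <= f x) ->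
  (\int[nu]_x (f x)%:E = (I f)%:E)%E.
Proof.
have unit g : bcont g -> (forall x, 0 <= g x <= 1) ->
    (\int[nu]_x (g x)%:E = (I g)%:E)%E.
  move=> bg g01; apply/eqP; rewrite eq_le integral_le_tp//=.
  have b1 : @bcont R X (fun=> 1) by exact: bcont_cst.
  have bh : bcont (fun x => 1 - g x) by exact: bcontB.
  have h01 x : 0 <= 1 - g x <= 1 by have := g01 x; lra.
  have := integral_le_tp _ bh h01; rewrite (tpB Itp)// => le_h.
  have : (\int[nu]_x (g x)%:E + \int[nu]_x (1 - g x)%:E = (I (fun=> 1%R))%:E)%E.
    rewrite -ge0_integralD//.
    - rewrite (eq_integral (cst 1%E)); last first.
        by move=> x _; rewrite -EFinD; congr EFin; rewrite /=; ring.
      by rewrite integral_cst// mul1e nuE daniellT.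
    - by move=> x _; rewrite lee_fin; have := g01 x; lra.
    - exact: mf.
    - by move=> x _; rewrite lee_fin; have := h01 x; lra.
    - exact: mf.
  have fin_h : (\int[nu]_x (1 - g x)%:E)%E \is a fin_num.
    rewrite ge0_fin_numE; first exact: le_lt_trans le_h (ltry _).
    by apply: integral_ge0 => x _; rewrite lee_fin; have := h01 x; lra.
  move=> sum1; rewrite -(leeD2rE _ _ fin_h) sum1.
  by rewrite (le_trans (leeD2l _ le_h))// -EFinD lee_fin; lra.
move=> bf f0; have [_ [M fM]] := bf; pose m := `|M| + 1.
have m0 : 0 < m by rewrite ltr_wpDl.
have fm x : f x <= m.
  by rewrite (le_trans (ler_norm _))// (le_trans (fM x))// ler_wpDr// ler_norm.
have bg : bcont (fun x => m^-1 * f x) by exact: bcontZ.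
have g01 x : 0 <= m^-1 * f x <= 1.
  by rewrite mulr_ge0 ?invr_ge0 ?(ltW m0)//= ler_pdivrMl// mulr1.
rewrite (eq_integral
  (fun x : borelType X => m%:E * (m^-1 * f x)%:E)%E); last first.
  by move=> x _; rewrite -EFinM mulVKf// gt_eqF.
rewrite ge0_integralZl_EFin ?(ltW m0)//.
- rewrite unit// -EFinM -(tpZ _ Itp)//; congr (I _)%:E.
  by apply/funext => x; rewrite mulVKf// gt_eqF.
- by move=> x _; rewrite lee_fin; have /andP[] := g01 x.
- exact: mf.
Qed.

End representation.

Theorem riesz_tight {R : realType} {X : ptopologicalType} (I : (X -> R) -> R) :
  tight_positive I -> (forall U : set X, open U -> @cozero_covered R X U) ->
  exists nu : {measure set (borelType X) -> \bar R},
    forall f, bcont f -> (forall x, 0 <= f x) ->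
      (\int[nu]_x (f x)%:E = (I f)%:E)%E.
Proof.
move=> Itp Xcoz.
have [|nu nuE] := caratheodory_open_measure (daniell_outer I Itp).
  move=> U /Xcoz[f [bf f01 ->]]; apply: caratheodory_measurable_bigcup => n.
  exact: cozero_caratheodory.
by exists nu; exact: integral_tp.
Qed.

(** * Cozero sets in locally compact spaces *)

Section cozero_sets.
Context {R : realType} {X : ptopologicalType}.
Implicit Types (q : X -> R) (U K : set X).

Lemma proper_locally_compact q : continuous q ->
  (forall k, (1 <= k)%N -> compact [set x | q x <= k%:R]) ->
  locally_compact [set: X].
Proof.
move=> cq Kq x _.
pose k := (Num.truncn (q x)).+1.
have closed_k : closed [set y | q y <= k%:R].
  rewrite (_ : [set _ | _] = q @^-1` [set r | r <= k%:R])//.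
  by apply: closed_comp => [y _|]; [exact: cq|exact: closed_le].
exists [set y | q y <= k%:R].
  apply: filterS (_ : \forall y \near x, q y < k%:R); first by move=> y /ltW.
  by apply: (cvgr_lt (q x)); [exact: cq|exact: truncnS_gt].
by split=> //; exact: Kq.
Qed.

Lemma finite_union_cozero (F : X -> X -> R) (s : seq X) :
  (forall z, z \in s -> bcont (F z) /\ forall x, 0 <= F z x <= 1) ->
  exists f : X -> R, [/\ bcont f, forall x, 0 <= f x <= 1 &
    [set x | 0 < f x] = \bigcup_(z in [set` s]) [set x | 0 < F z x]].
Proof.
elim: s => [|z s IHs] Fs.
  exists (fun=> 0); split=> [|x|]; [exact: bcont_cst|by rewrite lexx ler01|].
  by rewrite set_nil bigcup_set0; apply/seteqP; split=> x //=; rewrite ltxx.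
have [|f [bf f01 fE]] := IHs.
  by move=> y ys; apply: Fs; rewrite inE ys orbT.
have [bz z01] := Fs z (mem_head _ _).
exists (fun x => Num.max (F z x) (f x)); split=> [|x|].
- exact: bcont_max.
- by case: (leP (F z x) (f x)).
- apply/seteqP; split=> x /=; rewrite lt_max.
    case/orP=> [zx|fx]; first by exists z; rewrite //= mem_head.
    have : [set x | 0 < f x] x by [].
    by rewrite fE => -[y /= ys yx]; exists y; rewrite //= inE ys orbT.
  case=> y /=; rewrite inE => /predU1P[->|ys] yx; first by rewrite yx.
  have : [set x | 0 < f x] x by rewrite fE; exists y.
  by move=> /= ->; rewrite orbT.
Qed.

(** A compact subset of U is covered by finitely many cozero sets inside U, and
    their union is the cozero set of the maximum of the functions. *)
Lemma sigma_compact_cozero U : hausdorff_space X -> locally_compact [set: X] ->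
  open U -> sigma_compact U -> @cozero_covered R X U.
Proof.
move=> hX lX oU [K cK UK].
have [F FP] : {F : X -> X -> R & forall z, U z -> [/\ bcont (F z),
    forall x, 0 <= F z x <= 1, 0 < F z z & forall x, 0 < F z x -> U x]}.
  apply: (@choice _ _ (fun z f => U z -> [/\ bcont f,
    forall x, 0 <= f x <= 1, 0 < f z & forall x, 0 < f x -> U x])) => z.
  have [Uz|] := pselect (U z); last by exists (fun=> 0).
  have /uniform_separatorP : uniform_separator [set z] (~` U).
    apply: (@locally_compact_completely_regular X R lX hX).
      exact: open_closedC.
    by move=> /(_ Uz).
  move=> /(_ R)[f [cf f01 fz fU]].
  have {}f01 x : 0 <= f x <= 1.
    have : `[0, 1]%classic (f x) by apply: f01; exists x.
    by rewrite /= in_itv.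
  exists (fun x => 1 - f x) => _; split.
  - apply: bcontB; first exact: bcont_cst.
    by split=> //; exists 1 => x; have := f01 x; rewrite ler_norml; lra.
  - by move=> x; have := f01 x; lra.
  - by rewrite (_ : f z = 0) ?subr0//; apply: fz; exists z.
  - move=> x; apply: contraPP => nUx.
    by rewrite (_ : f x = 1) ?subrr ?ltxx//; apply: fU; exists x.
have KU n : K n `<=` U by rewrite UK; exact: bigcup_sup.
have [f fP] : {f : nat -> X -> R & forall n, [/\ bcont (f n),
    forall x, 0 <= f n x <= 1, K n `<=` [set x | 0 < f n x] &
    [set x | 0 < f n x] `<=` U]}.
  apply: (@choice _ _ (fun n f => [/\ bcont f,
    forall x, 0 <= f x <= 1, K n `<=` [set x | 0 < f x] &
    [set x | 0 < f x] `<=` U])) => n.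
  have := cK n; rewrite compact_cover.
  move=> /(_ X U (fun z => [set x | 0 < F z x])).
  have oF z : U z -> open [set x | 0 < F z x].
    move=> /FP[[cF _] _ _ _].
    rewrite (_ : [set _ | _] = F z @^-1` [set r | 0 < r])//.
    by apply: open_comp => [x _|]; [exact: cF|exact: open_gt].
  move=> /(_ oF)[|D DU KD].
    by move=> z /KU Uz; exists z => //; have [] := FP z Uz.
  have [|h [bh h01 hE]] := finite_union_cozero F (finmap.enum_fset D).
    by move=> z /DU; rewrite inE => /FP[].
  exists h; split=> //; rewrite hE; first exact: KD.
  by move=> x [z zD]; have [_ _ _] := FP z (set_mem (DU z zD)); exact.
exists f; split; [by move=> n; have [] := fP n|by move=> n; have [] := fP n|].
apply/seteqP; split; last by move=> x [n _]; have [_ _ _] := fP n; exact.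
rewrite {1}UK => x [n _ Kx]; exists n => //.
by have [_ _ Kf _] := fP n; exact: Kf.
Qed.

End cozero_sets.

(** * A functional squeezed by a positive functional on fractions *)

Section fraction_functional.
Context {R : realType} {A : comAlgType R} {D : mulrClosed A}
  {X : ptopologicalType} (hat : {lrmorphism A -> (X -> R)}).
Hypothesis hat_continuous : forall a : A, continuous (hat a).
Variable L : {scalar localization D}.
Hypothesis L_pos : forall (a d : A) (dD : d \in D),
  (forall x : X, 0 <= hat a x * hat d x) -> 0 <= L (locfrac a dD).
Implicit Types (a b d e : A) (f g : X -> R).

Lemma hat1 x : hat 1 x = 1. Proof. by rewrite rmorph1. Qed.
Lemma hatD a b x : hat (a + b) x = hat a x + hat b x.
Proof. by rewrite raddfD. Qed.
Lemma hatM a b x : hat (a * b) x = hat a x * hat b x.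
Proof. by rewrite rmorphM. Qed.
Lemma hatZ (k : R) a x : hat (k *: a) x = k * hat a x.
Proof. by rewrite linearZ. Qed.

Let hatE := (hat1, hatD, hatM, hatZ).

Lemma fractionZ (k : R) a d (dD : d \in D) :
  k * L (locfrac a dD) = L (locfrac (k *: a) dD).
Proof. by rewrite -locfracZ; exact/esym/scalarZ. Qed.

Lemma fractionDZ (k : R) a d b e (dD : d \in D) (eD : e \in D) :
  L (locfrac a dD) + k * L (locfrac b eD) =
  L (locfrac (a * e + (k *: b) * d) (rpredM dD eD)).
Proof. by rewrite -locfracD raddfD fractionZ. Qed.

Lemma fraction_le a d b e (dD : d \in D) (eD : e \in D) :
  (forall x, hat d x != 0 -> hat e x != 0 ->
    hat a x / hat d x <= hat b x / hat e x) ->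
  L (locfrac a dD) <= L (locfrac b eD).
Proof.
move=> ab; rewrite -subr_ge0 -mulN1r fractionDZ; apply: L_pos => x.
rewrite !hatE; have [->|d0] := eqVneq (hat d x) 0; first by rewrite !mulr0.
have [->|e0] := eqVneq (hat e x) 0; first by rewrite !mul0r !mulr0.
have -> : (hat b x * hat d x + -1 * hat a x * hat e x) * (hat e x * hat d x) =
    (hat b x / hat e x - hat a x / hat d x) * (hat e x * hat d x) ^+ 2.
  by field; rewrite d0 e0.
by rewrite mulr_ge0 ?sqr_ge0// subr_ge0 ab.
Qed.

Definition majorized g a d :=
  forall x, hat d x != 0 -> g x <= hat a x / hat d x.

Definition majorant_values g : set R := [set r | exists a d (dD : d \in D),
  majorized g a d /\ r = L (locfrac a dD)].

(** The best upper bound that L imposes on the value at g of a functional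
    squeezed by L. *)
Definition majorant_inf g := inf (majorant_values g).

Lemma majorant_values_lb g b e (eD : e \in D) :
  (forall x, hat e x != 0 -> hat b x / hat e x <= g x) ->
  lbound (majorant_values g) (L (locfrac b eD)).
Proof.
move=> bg _ [a [d [dD [ga ->]]]]; apply: fraction_le => x e0 d0.
exact: le_trans (bg _ e0) (ga _ d0).
Qed.

Let one_D : (1 : A) \in D := rpred1 D.

Lemma bcont_bounds g : bcont g ->
  has_lbound (majorant_values g) /\ majorant_values g !=set0.
Proof.
move=> [_ [M gM]]; split.
  exists (L (locfrac (- M *: 1) one_D)); apply: majorant_values_lb => x _.
  by rewrite !hatE divr1 mulr1; have := gM x; rewrite ler_norml => /andP[].
exists (L (locfrac (M *: 1) one_D)), (M *: 1), 1, one_D; split=> // x _.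
by rewrite !hatE divr1 mulr1 (le_trans (ler_norm _)).
Qed.

Lemma majorant_inf_le g a d (dD : d \in D) : bcont g -> majorized g a d ->
  majorant_inf g <= L (locfrac a dD).
Proof.
by move=> /bcont_bounds[lb _] ga; apply: ge_inf => //; exists a, d, dD.
Qed.

Lemma majorant_inf_sublinear : @sublinear_on R (X -> R) bcont majorant_inf.
Proof.
have pZ (k : R) g : 0 <= k -> bcont g -> forall r, majorant_values g r ->
    majorant_inf (k *: g) <= k * r.
  move=> k0 bg _ [a [d [dD [ga ->]]]]; rewrite fractionZ.
  apply: majorant_inf_le; first exact: bcontZ.
  by move=> x d0; rewrite hatE -mulrA ler_wpM2l ?ga.
split=> [f g bf bg|k g k0 bg].
  have [_ nf] := bcont_bounds _ bf; have [_ ng] := bcont_bounds _ bg.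
  rewrite -lerBlDr; apply: lb_le_inf => // _ [a [d [dD [fa ->]]]].
  rewrite lerBlDr -lerBlDl; apply: lb_le_inf => // _ [b [e [eD [gb ->]]]].
  rewrite lerBlDl -[L (locfrac b eD)]mul1r fractionDZ.
  apply: majorant_inf_le; first exact: bcontD.
  move=> x; rewrite !hatE mulf_eq0 negb_or => /andP[d0 e0].
  have -> : (hat a x * hat e x + 1 * hat b x * hat d x) / (hat d x * hat e x) =
     hat a x / hat d x + hat b x / hat e x by field; rewrite d0 e0.
  by apply: lerD; [exact: fa|exact: gb].
have [_ ng] := bcont_bounds _ bg.
move: k0; rewrite le_eqVlt => /predU1P[<-|k0].
  by have [r gr] := ng; rewrite mul0r -[leRHS](mul0r r); exact: pZ.
rewrite mulrC -ler_pdivrMr//; apply: lb_le_inf => // r gr.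
by rewrite ler_pdivrMr// mulrC pZ// ltW.
Qed.

Definition sandwiched (I : (X -> R) -> R) := forall g, bcont g ->
  forall a d (dD : d \in D),
  (majorized g a d -> I g <= L (locfrac a dD)) /\
  ((forall x, hat d x != 0 -> hat a x / hat d x <= g x) ->
    L (locfrac a dD) <= I g).

Lemma sandwiched_functional :
  (exists2 q : A, (forall x : X, 0 <= hat q x) &
    forall k : nat, (1 <= k)%N -> compact [set x : X | hat q x <= k%:R]) ->
  exists2 I : (X -> R) -> R, tight_positive I & sandwiched I.
Proof.
move=> [q q0 cq].
have [I [ID IZ Ip]] :=
  hahn_banach _ (@bcontD R X) (@bcontZ R X) _ majorant_inf_sublinear.
have Iup g a d (dD : d \in D) :
    bcont g -> majorized g a d -> I g <= L (locfrac a dD).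
  by move=> bg ga; rewrite (le_trans (Ip _ bg))// majorant_inf_le.
have Ilow g a d (dD : d \in D) : bcont g ->
    (forall x, hat d x != 0 -> hat a x / hat d x <= g x) ->
    L (locfrac a dD) <= I g.
  move=> bg ga; rewrite -lerN2 -mulN1r -[leRHS]mulN1r.
  rewrite fractionZ -(IZ _ _ bg).
  apply: Iup; first exact: bcontZ.
  move=> x d0; change (-1 * g x <= hat (-1 *: a) x / hat d x).
  by rewrite hatE -mulrA !mulN1r lerN2 ga.
exists I; last by move=> g bg a d dD; split; [exact: Iup|exact: Ilow].
split=> //.
- move=> g bg g0; apply: le_trans (Ilow g 0 1 one_D bg _).
    by apply: L_pos => x; rewrite raddf0 mul0r.
  by move=> x _; rewrite raddf0 mul0r.
- move=> e e0; pose r := L (locfrac q one_D).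
  have r0 : 0 <= r by apply: L_pos => x; rewrite hat1 mulr1.
  pose k := (Num.truncn (r / e)).+1.
  exists [set x | hat q x <= k%:R]; first exact: cq.
  move=> g bg g01 gK; apply: (@le_trans _ _ (k%:R^-1 * r)).
    rewrite fractionZ; apply: Iup => // x _; rewrite !hatE divr1.
    have [/gK ->|qk] := leP (hat q x) k%:R; first by rewrite mulr_ge0 ?invr_ge0.
    have /andP[_ g1] := g01 x; apply: (le_trans g1).
    by rewrite ler_pdivlMl ?ltr0n// mulr1 ltW.
  by rewrite ler_pdivrMl ?ltr0n// -ler_pdivrMr// ltW// truncnS_gt.
Qed.

End fraction_functional.

(** * Bounded continuous approximations of fractions *)

(** With t and s the values of a and d ^ 2, this is the function written g_n
    above, for n + 1.  The summand 1 + t makes it bounded by n + 1, whatever the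
    growth of t, and keeps the denominator positive where s vanishes. *)
Definition approx {R : realType} (t s : R) (n : nat) : R :=
  n.+1%:R * t / (n.+1%:R * s + 1 + t).

Section approx_theory.
Context {R : realType}.
Implicit Types (t s : R) (n : nat).

Lemma approx_bounds t s n : 0 <= t -> 0 <= s -> 0 <= approx t s n <= n.+1%:R.
Proof.
move=> t0 s0; have N0 : 0 < n.+1%:R :> R by rewrite ltr0n.
have den0 : 0 < n.+1%:R * s + 1 + t by have := mulr_ge0 (ltW N0) s0; lra.
rewrite divr_ge0 ?(ltW den0) ?mulr_ge0 ?(ltW N0)//=.
rewrite ler_pdivrMr// ler_wpM2l ?(ltW N0)//.
by have := mulr_ge0 (ltW N0) s0; lra.
Qed.

Lemma approx_le t s n : 0 <= t -> 0 < s -> approx t s n <= t / s.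
Proof.
move=> t0 s0; have N0 : 0 < n.+1%:R :> R by rewrite ltr0n.
have den0 : 0 < n.+1%:R * s + 1 + t by have := mulr_gt0 N0 s0; lra.
rewrite ler_pdivrMr// mulrAC ler_pdivlMr//.
by have := mulr_ge0 t0 t0; rewrite -subr_ge0; nra.
Qed.

Lemma approx_ge t s n : 0 <= t -> 0 < s ->
  t / s - n.+1%:R^-1 * (t * (1 + t) / (s * s)) <= approx t s n.
Proof.
move=> t0 s0; have N0 : 0 < n.+1%:R :> R by rewrite ltr0n.
rewrite /approx; move: (n.+1%:R) N0 => N N0.
have den0 : 0 < N * s + 1 + t by have := mulr_gt0 N0 s0; lra.
rewrite -subr_ge0.
have -> : N * t / (N * s + 1 + t) - (t / s - N^-1 * (t * (1 + t) / (s * s))) =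
    t * (1 + t) ^+ 2 / (N * (s * s) * (N * s + 1 + t)).
  by field; rewrite !gt_eqF.
apply: divr_ge0; first by rewrite mulr_ge0 ?sqr_ge0.
by rewrite ltW// !mulr_gt0.
Qed.

Lemma approx_homo t s : 0 <= t -> 0 <= s ->
  {homo approx t s : m n / (m <= n)%N >-> m <= n}.
Proof.
move=> t0 s0 m n mn; have le_mn : m.+1%:R <= n.+1%:R :> R by rewrite ler_nat.
have M0 : 0 < m.+1%:R :> R by rewrite ltr0n.
have N0 : 0 < n.+1%:R :> R by rewrite ltr0n.
have dm0 : 0 < m.+1%:R * s + 1 + t by have := mulr_ge0 (ltW M0) s0; lra.
have dn0 : 0 < n.+1%:R * s + 1 + t by have := mulr_ge0 (ltW N0) s0; lra.
rewrite /approx ler_pdivrMr// mulrAC ler_pdivlMr// -subr_ge0.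
rewrite (_ : _ - _ = (n.+1%:R - m.+1%:R) * (t * (1 + t))); last by ring.
by rewrite !mulr_ge0 ?subr_ge0 ?addr_ge0.
Qed.

Lemma approx_cvg t s : 0 <= t -> 0 < s -> approx t s @ \oo --> t / s.
Proof.
move=> t0 s0.
apply: (@squeeze_cvgr _ _ _ _
  (fun n => t / s - n.+1%:R^-1 * (t * (1 + t) / (s * s))) (fun=> t / s)).
- by apply: nearW => n; rewrite approx_ge//= approx_le.
- rewrite -[X in _ --> X]subr0 -[X in _ - X](mul0r (t * (1 + t) / (s * s))).
  apply: cvgB; first exact: cvg_cst.
  by apply: cvgM; [exact: cvg_harmonic|exact: cvg_cst].
- exact: cvg_cst.
Qed.

Lemma bcont_approx {X : ptopologicalType} (f g : X -> R) n :
  continuous f -> continuous g ->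
  (forall x, 0 <= f x) -> (forall x, 0 <= g x) ->
  bcont (fun x => approx (f x) (g x) n).
Proof.
move=> cf cg f0 g0; split; last first.
  exists n.+1%:R => x; have /andP[a0 an] := approx_bounds _ _ n (f0 x) (g0 x).
  by rewrite ger0_norm.
move=> x; apply: cvgM.
  by apply: cvgM; [exact: cvg_cst|exact: cf].
apply: cvgV.
  rewrite gt_eqF//; have := mulr_ge0 (ler0n R n.+1) (g0 x).
  by have := f0 x; lra.
apply: cvgD; last exact: cf.
by apply: cvgD; [apply: cvgM; [exact: cvg_cst|exact: cg]|exact: cvg_cst].
Qed.

(** With the convention 1 / 0 = 0 the quotient is an everywhere limit of the
    continuous functions f g / (g ^ 2 + 1 / n), also on the zero set of g. *)
Lemma measurable_quotient {X : ptopologicalType} (f g : X -> R) :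
  continuous f -> continuous g ->
  measurable_fun [set: borelType X] (fun x => f x / g x).
Proof.
move=> cf cg.
pose h n (x : borelType X) : R := f x * g x / (g x ^+ 2 + n.+1%:R^-1).
apply: (@measurable_fun_cvg _ (borelType X) R setT h).
  move=> n; apply: borel_measurable_fun => x.
  apply: cvgM; first by apply: cvgM; [exact: cf|exact: cg].
  apply: cvgV; first by rewrite gt_eqF// ltr_wpDl ?sqr_ge0// invr_gt0 ltr0n.
  by apply: cvgD; [apply: cvgM; exact: cg|exact: cvg_cst].
move=> x _; have [gx0|gx0] := eqVneq (g x) 0.
  by rewrite /h gx0 invr0 !mulr0; under eq_fun do rewrite mul0r; exact: cvg_cst.
have -> : f x / g x = f x * g x / (g x ^+ 2 + 0) by field.
apply: cvgM; first exact: cvg_cst.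
apply: cvgV; first by rewrite addr0 sqrf_eq0.
by apply: cvgD; [exact: cvg_cst|exact: cvg_harmonic].
Qed.

End approx_theory.

(** * Integrals of fractions *)

Section fraction_integral.
Context {R : realType} {A : comAlgType R} {D : mulrClosed A}
  {X : ptopologicalType} (hat : {lrmorphism A -> (X -> R)}).
Hypothesis hat_continuous : forall a : A, continuous (hat a).
Variables (L : {scalar localization D}) (I : (X -> R) -> R).
Hypothesis L_pos : forall (a d : A) (dD : d \in D),
  (forall x : X, 0 <= hat a x * hat d x) -> 0 <= L (locfrac a dD).
Hypothesis Isand : sandwiched hat L I.
Variable mu : {measure set (borelType X) -> \bar R}.
Hypothesis muI : forall f, bcont f -> (forall x, 0 <= f x) ->
  (\int[mu]_x (f x)%:E = (I f)%:E)%E.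
Implicit Types a d : A.

Let g a d n x := approx (hat a x) (hat (d * d) x) n.

Lemma hat_sqr_gt0 d x : hat d x != 0 -> 0 < hat (d * d) x.
Proof. by move=> d0; rewrite hatM -expr2 exprn_even_gt0. Qed.

Let hat_sqr_ge0 d x : 0 <= hat (d * d) x.
Proof. by rewrite hatM -expr2 sqr_ge0. Qed.

Let bg a d n : (forall x, 0 <= hat a x) -> bcont (g a d n).
Proof. by move=> a0; exact: bcont_approx. Qed.

Let g_ge0 a d n x : (forall x, 0 <= hat a x) -> 0 <= g a d n x.
Proof.
by move=> a0; have /andP[] := approx_bounds _ _ n (a0 x) (hat_sqr_ge0 d x).
Qed.

Lemma I_approx_le a d n (dD : d \in D) : (forall x, 0 <= hat a x) ->
  I (g a d n) <= L (locfrac a (rpredM dD dD)).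
Proof.
move=> a0; apply: (Isand _ (bg a d n a0) _ _ _).1 => x.
by move=> dd0; apply: approx_le => //; rewrite lt0r dd0 hat_sqr_ge0.
Qed.

Lemma I_approx_cvg a d (dD : d \in D) : (forall x, 0 <= hat a x) ->
  I (g a d n) @[n --> \oo] --> (L (locfrac a (rpredM dD dD)) : R).
Proof.
move=> a0; set l := L _.
pose ddD := rpredM dD dD.
pose m := L (locfrac (a * (1 + a)) (rpredM ddD ddD)).
apply: (@squeeze_cvgr _ _ _ _ (fun n => l - n.+1%:R^-1 * m) (fun=> l)).
- apply: nearW => n; rewrite I_approx_le// andbT -mulNr fractionDZ.
  apply: (Isand _ (bg a d n a0) _ _ _).2 => x.
  rewrite !(hatM, hatD, hatZ, hat1) !mulf_eq0 !orbb => d0.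
  apply: le_trans (approx_ge _ _ n (a0 x) (hat_sqr_gt0 _ _ d0)).
  rewrite hatM le_eqVlt; apply/orP; left; apply/eqP; field.
  by rewrite d0 /= -[1]/(1%:R) -natrD pnatr_eq0.
- rewrite -[X in _ --> X]subr0 -[X in _ - X](mul0r m).
  apply: cvgB; first exact: cvg_cst.
  by apply: cvgM; [exact: cvg_harmonic|exact: cvg_cst].
- exact: cvg_cst.
Qed.

Let Z d : set (borelType X) := [set x | hat d x = 0].

Let mZ d : measurable (Z d).
Proof.
have oC : open (~` [set x | hat d x = 0]).
  rewrite (_ : ~` _ = hat d @^-1` [set r | r != 0]); last first.
    by apply/seteqP; split=> x /= /eqP.
  by apply: open_comp => [x _|]; [exact: hat_continuous|exact: open_neq].
rewrite -[Z d]setCK; apply: measurableC. apply: sub_sigma_algebra; exact: oC.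
Qed.

Let mg a d n : (forall x, 0 <= hat a x) ->
  measurable_fun [set: borelType X] (fun x => (g a d n x)%:E).
Proof.
move=> a0; apply/measurable_EFinP; apply: borel_measurable_fun.
exact: (bg a d n a0).1.
Qed.

(** On the zero set of d the approximations of 1 / d ^ 2 equal (n + 1) / 2, but
    their integrals stay below L (1 / d ^ 2). *)
Lemma zero_set_negligible d : d \in D -> mu [set x | hat d x = 0] = 0%E.
Proof.
move=> dD; rewrite -/(Z d); set l := L (locfrac 1 (rpredM dD dD)).
have one0 x : 0 <= hat 1 x by rewrite hat1.
have le_n n : (mu (Z d) <= (n.+1%:R^-1 * (2 * l))%:E)%E.
  have N0 : 0 < n.+1%:R :> R by rewrite ltr0n.
  have : ((n.+1%:R / 2)%:E * mu (Z d) <= l%:E)%E.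
    apply: (@le_trans _ _ (\int[mu]_x (g 1 d n x)%:E)%E); last first.
      rewrite muI; [|exact: bg|by move=> x; exact: g_ge0].
      by rewrite lee_fin; exact: I_approx_le.
    rewrite -[X in (_ * mu X)%E](setIT (Z d)) -integral_indic//.
    rewrite -(integralZl_indic measurableT (fun=> Z d))//; last first.
      by rewrite ltNge divr_ge0.
    apply: ge0_le_integral => //.
    - by apply/measurable_EFinP; apply: measurable_funM.
    - exact: mg.
    - move=> x _; rewrite lee_fin indicE.
      have [/set_mem zx|_] := boolP (x \in Z d).
        by rewrite /g /approx hat1 hatM zx !mulr0 add0r !mulr1.
      by rewrite mulr0 g_ge0.
  rewrite -lee_pdivlMl ?divr_gt0// -EFinM => /le_trans; apply.
  by rewrite lee_fin invf_div mulrAC mulrC.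
have l0 : 0 <= 2 * l.
  by have := le_trans (measure_ge0 _ _) (le_n 0); rewrite invr1 mul1r lee_fin.
apply/eqP; rewrite eq_le measure_ge0 andbT.
apply/lee_addgt0Pr => e e0; rewrite add0e.
apply: (le_trans (le_n (Num.truncn (2 * l / e)))); rewrite lee_fin.
by rewrite ler_pdivrMl ?ltr0n// -ler_pdivrMr// ltW// truncnS_gt.
Qed.

Lemma square_fraction_integral a d (dD : d \in D) : (forall x, 0 <= hat a x) ->
  (\int[mu]_x (hat a x / hat (d * d) x)%:E =
    (L (locfrac a (rpredM dD dD)))%:E)%E.
Proof.
move=> a0; have muZ : mu (Z d) = 0%E by exact: zero_set_negligible.
have offZ (f : borelType X -> \bar R) : measurable_fun setT f ->
    (forall x, 0 <= f x)%E ->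
    (\int[mu]_x f x = \int[mu]_(x in setT `\` Z d) f x)%E.
  by move=> mf f0; apply: ge0_negligible_integral.
rewrite offZ; last 2 first.
- apply/measurable_EFinP.
  by apply: (measurable_quotient (hat a) (hat (d * d))).
- by move=> x; rewrite lee_fin divr_ge0.
rewrite (eq_integral
  (fun x : borelType X => limn (fun n => (g a d n x)%:E))); last first.
  move=> x /set_mem[_ /eqP d0]; apply/esym/cvg_lim => //.
  apply: cvg_EFin; first exact: nearW.
  by apply: approx_cvg => //; exact: hat_sqr_gt0.
rewrite monotone_convergence//; last 4 first.
- by apply: measurableD.
- by move=> n; apply: (measurable_funS measurableT) => //; exact: mg.
- by move=> n x _; rewrite lee_fin g_ge0.
- by move=> x _ m n mn; rewrite lee_fin approx_homo.
rewrite (_ : (fun n => _) = (fun n => (I (g a d n))%:E)); last first.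
  apply/funext => n.
  rewrite -offZ; [|exact: mg|by move=> x; rewrite lee_fin g_ge0].
  by rewrite muI//; [exact: bg|move=> x; exact: g_ge0].
by apply/cvg_lim => //; apply: cvg_EFin; [exact: nearW|exact: I_approx_cvg].
Qed.

Lemma square_fraction_integrable b d : d \in D ->
  mu.-integrable [set: borelType X]
    (fun x => (hat (b * b) x / hat (d * d) x)%:E).
Proof.
move=> dD; apply/integrableP; split.
  apply/measurable_EFinP.
  by apply: (measurable_quotient (hat (b * b)) (hat (d * d))).
rewrite (eq_integral
  (fun x : borelType X => (hat (b * b) x / hat (d * d) x)%:E)).
  by rewrite (square_fraction_integral _ _ dD)// ltry.
by move=> x _; rewrite gee0_abs// lee_fin divr_ge0.
Qed.

(** On the zero set of d both sides are 0 by the convention 1 / 0 = 0, so the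
    identity needs no restriction. *)
Lemma fraction_polarisation a d x : hat a x / hat d x =
  4^-1 * (hat ((a + d) * (a + d)) x / hat (d * d) x) +
  - 4^-1 * (hat ((a - d) * (a - d)) x / hat (d * d) x).
Proof.
rewrite !hatM hatD raddfB /=; have [->|d0] := eqVneq (hat d x) 0.
  by rewrite !(mulr0, invr0, addr0).
by change ((hat a - hat d) x) with (hat a x - hat d x); field.
Qed.

Lemma fraction_integral a d (dD : d \in D) :
  mu.-integrable [set: borelType X] (fun x => (hat a x / hat d x)%:E) /\
  ((L (locfrac a dD))%:E = \int[mu]_x (hat a x / hat d x)%:E)%E.
Proof.
pose u b (x : borelType X) := (hat (b * b) x / hat (d * d) x)%:E.
have iu b k : mu.-integrable setT (fun x => k%:E * u b x)%E.
  by apply: integrableZl => //; exact: square_fraction_integrable.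
have Lu b k : (\int[mu]_x (k%:E * u b x) =
    (k * L (locfrac (b * b) (rpredM dD dD)))%:E)%E.
  rewrite integralZl//; last exact: square_fraction_integrable.
  by rewrite square_fraction_integral.
have aE : (fun x : borelType X => (hat a x / hat d x)%:E) =
    (fun x => (4^-1)%:E * u (a + d)%R x + (- 4^-1)%:E * u (a - d)%R x)%E.
  by apply/funext => x; rewrite fraction_polarisation EFinD !EFinM.
rewrite aE; split; first exact: integrableD.
rewrite integralD// !Lu -EFinD; congr EFin.
rewrite fractionZ fractionDZ.
have same x : hat d x != 0 -> hat a x / hat d x =
    hat (4^-1 *: ((a + d) * (a + d)) * (d * d) +
         - 4^-1 *: ((a - d) * (a - d)) * (d * d)) x / hat (d * d * (d * d)) x.
  move=> d0; rewrite fraction_polarisation hatD !hatM !hatZ !hatM; field.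
  by rewrite d0.
have dd0 x : hat (d * d * (d * d)) x != 0 -> hat d x != 0.
  by rewrite !hatM !mulf_eq0 !orbb.
apply/eqP; rewrite eq_le; apply/andP.
by split; apply: (fraction_le _ _ L_pos) => x ? ?; rewrite same//; exact: dd0.
Qed.

End fraction_integral.

Theorem theorem3 (R : realType) (A : comAlgType R) (D : mulrClosed A)
  (X : ptopologicalType) (X_hausdorff : hausdorff_space X)
  (hat : {lrmorphism A -> (X -> R)})
  (hat_continuous : forall a : A, continuous (hat a))
  (h1 : exists2 q : A, (forall x : X, 0 <= hat q x) &
    forall k : nat, (1 <= k)%N -> compact [set x : X | hat q x <= k%:R])
  (h2 : forall d : A, d \in D -> interior [set x : X | hat d x = 0] = set0)
  (h3 : forall U : set X, open U -> sigma_compact U)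
  (L : {scalar localization D})
  (L_pos : forall (a d : A) (dD : d \in D),
    (forall x : X, 0 <= hat a x * hat d x) -> 0 <= L (locfrac a dD)) :
  exists mu : {measure set (borelType X) -> \bar R},
    forall (a d : A) (dD : d \in D),
      [/\ mu [set x : X | hat d x = 0] = 0%E,
          mu.-integrable [set: X] (fun x => (hat a x / hat d x)%:E) &
          (L (locfrac a dD))%:E = (\int[mu]_(x in [set: X]) (hat a x / hat d x)%:E)%E].
Proof.
have Xlc : locally_compact [set: X].
  have [q _ cq] := h1; apply: (proper_locally_compact (hat q)) => //.
have [I Itp Isand] := sandwiched_functional hat L L_pos h1.
have [U oU|mu muI] := riesz_tight I Itp.
  by apply: sigma_compact_cozero => //; exact: h3.
exists mu => a d dD.
have [int_ad L_ad] :=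
  fraction_integral hat hat_continuous L I L_pos Isand mu muI a d dD.
split=> //.
exact: (zero_set_negligible hat hat_continuous L I Isand mu muI).
Qed.
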